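(* Let $\mathcal{I}$ be an admissible ideal in $\mathbb{N}$, let $\{x_n\}_{n\in\mathbb{N}}$ be a sequence in a metric-like space $(\mathcal{X},\delta)$ and let $x_o\in\mathcal{X}$. If $\{x_n\}_{n\in\mathbb{N}}$ is $\mathcal{I}^{*}$-convergent to $x_o$, then $\{x_n\}_{n\in\mathbb{N}}$ is $\mathcal{I}$-convergent to $x_o$.
   Context: A metric-like space is a pair $(\mathcal{X},\delta)$ where $\mathcal{X}$ is a non-empty set and $\delta:\mathcal{X}\times\mathcal{X}\to\mathbb{R}_{\ge 0}$ satisfies, for all $x,y,z\in\mathcal{X}$: (1) $\delta(x,y)=0\Rightarrow x=y$; (2) $\delta(x,y)=\delta(y,x)$; (3) $\delta(x,y)\le\delta(x,z)+\delta(z,y)$. The value $\delta(x,x)$ may be positive. An ideal in $\mathbb{N}$ is a non-empty class $\mathcal{I}$ of subsets of $\mathbb{N}$ containing $\emptyset$, closed under finite unions and under taking subsets. It is admissible if $\mathbb{N}\notin\mathcal{I}$, $\mathcal{I}\ne\{\emptyset\}$, and $\{z\}\in\mathcal{I}$ for every $z\in\mathbb{N}$. The associated filter is $\mathcal{F}(\mathcal{I})=\{\mathbb{N}\setminus A: A\in\mathcal{I}\}$. A sequence $\{x_n\}$ in $(\mathcal{X},\delta)$ is $\mathcal{I}$-convergent to $x_o\in\mathcal{X}$ if for every $\epsilon>0$ the set $\{n\in\mathbb{N}: |\delta(x_n,x_o)-\delta(x_o,x_o)|\ge\epsilon\}$ belongs to $\mathcal{I}$. It is $\mathcal{I}^{*}$-convergent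 to $x_o\in\mathcal{X}$ if there exists $M=\{n_1<n_2<\cdots\}\in\mathcal{F}(\mathcal{I})$ such that $\lim_{k\to\infty}\delta(x_{n_k},x_o)=\delta(x_o,x_o)$. *)

(* Defs.v *)
From mathcomp Require Import all_boot all_order all_algebra.
From mathcomp Require Import all_classical all_reals topology normedtype.

Set Implicit Arguments.
Unset Strict Implicit.
Unset Printing Implicit Defensive.

Import Order.TTheory GRing.Theory Num.Theory.
Import numFieldNormedType.Exports.

Local Open Scope classical_set_scope.
Local Open Scope ring_scope.

Record metric_like (R : realType) (X : Type) (delta : X -> X -> R) : Prop :=
  MetricLike {
    ml_nonempty : [set: X] !=set0;
    ml_ge0 : forall x y, 0 <= delta x y;
    ml_eq : forall x y, delta x y = 0 -> x = y;
    ml_sym : forall x y, delta x y = delta y x;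
    ml_triangle : forall x y z, delta x y <= delta x z + delta z y }.

Record nat_ideal (I : set (set nat)) : Prop := NatIdeal {
  ideal_set0 : I set0;
  ideal_setU : forall A B, I A -> I B -> I (A `|` B);
  ideal_sub : forall A B, A `<=` B -> I B -> I A }.

Record admissible_ideal (I : set (set nat)) : Prop := AdmissibleIdeal {
  admissible_is_ideal : nat_ideal I;
  admissible_proper : ~ I [set: nat];
  admissible_nontrivial : I <> [set set0];
  admissible_set1 : forall z : nat, I [set z] }.

Definition ideal_filter (I : set (set nat)) : set (set nat) :=
  [set ~` A | A in I].

Definition ideal_cvg (R : realType) (X : Type) (delta : X -> X -> R)
    (I : set (set nat)) (x : nat -> X) (xo : X) : Prop :=
  forall e : R, 0 < e ->
    I [set n | `|delta (x n) xo - delta xo xo| >= e].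

(* The strictly increasing function [s] with range [M] is the enumeration
   n_1 < n_2 < ... of the (necessarily infinite) set M. *)
Definition ideal_star_cvg (R : realType) (X : Type) (delta : X -> X -> R)
    (I : set (set nat)) (x : nat -> X) (xo : X) : Prop :=
  exists (M : set nat) (s : nat -> nat),
    [/\ ideal_filter I M,
        {homo s : i j / (i < j)%N},
        range s = M &
        (fun k => delta (x (s k)) xo) @ \oo --> delta xo xo].

(* Main.v *)
Require Import Defs.
From mathcomp Require Import all_boot all_order all_algebra.
From mathcomp Require Import all_classical all_reals topology normedtype.

Import Order.TTheory GRing.Theory Num.Theory.
Import numFieldNormedType.Exports.

Local Open Scope classical_set_scope.
Local Open Scope ring_scope.

(** Write [M] as the complement of some [A] in [I]. Convergence along [M] leaves, for each [e], only
    finitely many bad indices in [M], so the bad set lies in the union of [A] and a finite set. That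
    union is in [I] by [admissible_ideal_finite]. *)

(** A finite set is a finite union of singletons, each of which is in [I]. *)
Lemma admissible_ideal_finite (I : set (set nat)) (A : set nat) :
  admissible_ideal I -> finite_set A -> I A.
Proof.
move=> [[I0 IU Isub] _ _ I1] /finite_seqP[s ->].
elim: s => [|z s IHs]; first by rewrite set_nil.
apply: (Isub _ ([set z] `|` [set` s])); last exact: IU.
by move=> y /=; rewrite inE => /orP[/eqP ->|]; [left|right].
Qed.

Theorem theorem4p1 (R : realType) (X : Type) (delta : X -> X -> R)
    (I : set (set nat)) (x : nat -> X) (xo : X) :
  metric_like delta -> admissible_ideal I ->
  ideal_star_cvg delta I x xo -> ideal_cvg delta I x xo.
Proof.
move=> _ admI [_ [s [[A IA <-] _ rangeE cvg_s]]] e e_gt0.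
have [N _ ltN] : \forall k \near \oo,
    `|delta xo xo - delta (x (s k)) xo| < e.
  by move/cvgrPdist_lt: cvg_s; apply.
have [_ IU Isub] := admissible_is_ideal admI.
(* Off A, the index n is some [s k], and only the k < N can be bad. *)
apply: (Isub _ (A `|` s @` `I_N)).
  move=> n /= le_e; have [An|nAn] := pselect (A n); [by left|right].
  have [k _ skn] : range s n by rewrite rangeE.
  (* If [N <= k], then [ltN] makes the gap at [n = s k] smaller than [e], against [le_e]. *)
  exists k => //=; rewrite ltnNge; apply/negP => leNk.
  by move: (ltN k leNk); rewrite /= skn distrC ltNge le_e.
apply: IU => //; apply: admissible_ideal_finite => //.
exact/finite_image/finite_II.
Qed.
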